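(* Let $0<\alpha<1$ be a given constant. Then for all $n\geq1$ and $3^{-n}\leq\epsilon\leq1/3$, the permutation testing problem $\operatorname{PTP}_{n,\alpha}$ has an $\epsilon$-error quantum query algorithm with cost $O(n^{1/3}\log^{2/3}(1/\epsilon))$. In particular, \[\deg_\epsilon(\operatorname{PTP}_{n,\alpha})=O\left(n^{1/3}\left(\log\frac1\epsilon\right)^{2/3}\right).\]
   Context: Let $\mathcal{D}_{n,n}$ be the set of Boolean $n\times n$ matrices with exactly one $1$ per row, viewed in $\{0,1\}^{n^2}\subseteq\mathbb{R}^{n^2}$; such a matrix is identified with the map $\phi\colon\{1,\dots,n\}\to\{1,\dots,n\}$ with $\phi(i)=j$ iff $x_{i,j}=1$. $\operatorname{PTP}_{n,\alpha}$ is defined on those inputs for which $|\operatorname{im}\phi|$ equals $n$ or is at most $\alpha n$, with value $1$ in the former case (permutations) and $0$ in the latter. An $\epsilon$-error quantum query algorithm with cost $T$ is given quantum query access to $\phi$, makes at most $T$ queries, and on every input in the domain outputs the correct value with probability at least $1-\epsilon$. For $f\colon X\to\mathbb{R}$, $X\subseteq\mathbb{R}^N$ finite, $\deg_\epsilon(f)$ is the least total degree of a real polynomial $p$ with $|p(x)-f(x)|\leq\epsilon$ for all $x\in X$ (no constraint outside $X$). The constants hidden in $O(\cdot)$ may depend on $\alpha$. *)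

(* Defs.v *)
From HB Require Import structures.
From mathcomp Require Import all_boot all_order all_algebra.
From mathcomp Require Import complex.
From mathcomp Require Import all_classical all_reals all_analysis.
(* The notations of [mpoly] clash with those of analysis. *)
From mathcomp Require mpoly.
Import -(notations) mpoly.

Set Implicit Arguments.
Unset Strict Implicit.
Unset Printing Implicit Defensive.

Import Order.TTheory GRing.Theory Num.Theory.

Local Open Scope ring_scope.
Local Open Scope complex_scope.
Local Open Scope classical_set_scope.

Definition addmod (n : nat) (j k : 'I_n) : 'I_n :=
  Ordinal (ltn_pmod (j + k) (leq_ltn_trans (leq0n j) (ltn_ord j))).

(* Computational basis: query register, answer register, workspace. *)
Definition qbasis (n : nat) (W : finType) : finType := ('I_n * 'I_n * W)%type.

(* The query |i>|j>|w> |-> |i>|j + phi(i) mod n>|w> on basis states. *)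
Definition query_basis (n : nat) (W : finType) (phi : {ffun 'I_n -> 'I_n})
    (b : qbasis n W) : qbasis n W :=
  let: (i, j, w) := b in (i, addmod j (phi i), w).

Definition query_mx (R : realType) (n : nat) (W : finType)
    (phi : {ffun 'I_n -> 'I_n}) : 'M[R[i]]_#|qbasis n W| :=
  \matrix_(r, c) (enum_val r == query_basis phi (enum_val c))%:R.

(* Only [qstep 0], ..., [qstep qcost] are ever applied; one query separates
   each of these input-independent unitaries from the next. *)
Record query_algorithm (R : realType) (n : nat) := QueryAlgorithm {
  qwork : finType;
  qcost : nat;
  qinit : qbasis n qwork;
  qstep : nat -> 'M[R[i]]_#|qbasis n qwork|;
  qstep_unitary : forall t, qstep t \is unitarymx;
  qout : qbasis n qwork -> bool }.

Arguments qout {R n} q b.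

Fixpoint qstate (R : realType) (n : nat) (A : query_algorithm R n)
    (phi : {ffun 'I_n -> 'I_n}) (t : nat) : 'cV[R[i]]_#|qbasis n (qwork A)| :=
  if t is t'.+1
  then qstep A t *m (query_mx R (qwork A) phi *m qstate A phi t')
  else qstep A 0 *m delta_mx (enum_rank (qinit A)) ord0.

(* Born rule, for a measurement of all registers in the computational basis
   after the last query. *)
Definition prob_output (R : realType) (n : nat) (A : query_algorithm R n)
    (phi : {ffun 'I_n -> 'I_n}) (v : bool) : R :=
  \sum_(b : qbasis n (qwork A) | qout A b == v)
     Normc.normc (qstate A phi (qcost A) (enum_rank b) ord0) ^+ 2.

Definition computes_with_error (R : realType) (n : nat)
    (A : query_algorithm R n) (dom : set {ffun 'I_n -> 'I_n})
    (f : {ffun 'I_n -> 'I_n} -> bool) (eps : R) : Prop :=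
  forall phi, dom phi -> 1 - eps <= prob_output A phi (f phi).

Definition ptp_dom (R : realType) (n : nat) (alpha : R) :
    set {ffun 'I_n -> 'I_n} :=
  [set phi | #|codom phi| = n \/ #|codom phi|%:R <= alpha * n%:R].

Definition ptp (n : nat) (phi : {ffun 'I_n -> 'I_n}) : bool :=
  #|codom phi| == n.

(* The Boolean matrix x with x i j = 1 iff phi i = j, as a point of R^(n*n). *)
Definition ptp_point (R : realType) (n : nat) (phi : {ffun 'I_n -> 'I_n}) :
    'rV[R]_(n * n) :=
  mxvec (\matrix_(i < n, j < n) (phi i == j)%:R).

Definition ptp_points (R : realType) (n : nat) (alpha : R) :
    set 'rV[R]_(n * n) :=
  ptp_point R (n := n) @` ptp_dom (n := n) alpha.

(* Only the values on [ptp_points] matter. *)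
Definition ptp_fun (R : realType) (n : nat) : 'rV[R]_(n * n) -> R :=
  \1_(ptp_point R (n := n) @` [set phi | ptp phi]).

Lemma ptp_point_inj (R : realType) (n : nat) :
  injective (@ptp_point R n).
Proof.
move=> f g /(can_inj (@mxvecK _ _ _))/matrixP fg; apply/ffunP => i.
move: (fg i (g i)); rewrite !mxE eqxx; case: eqP => // _ /eqP.
by rewrite eq_sym oner_eq0.
Qed.

Lemma ptp_funE (R : realType) (n : nat) (phi : {ffun 'I_n -> 'I_n}) :
  ptp_fun (ptp_point R phi) = (ptp phi)%:R.
Proof.
rewrite /ptp_fun indicE; congr (_%:R); congr nat_of_bool.
apply/idP/idP => [|h]; last by rewrite inE; exists phi.
by rewrite inE => -[psi /= h /ptp_point_inj <-].
Qed.

Definition approximates (R : realType) (N : nat) (X : set 'rV[R]_N)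
    (f : 'rV[R]_N -> R) (eps : R) (p : mpoly.mpoly N R) : Prop :=
  forall x, X x -> `|mpoly.meval (fun k => x ord0 k) p - f x| <= eps.

(* [(msize p).-1] is the total degree of p, with degree 0 for p = 0. The
   infimum is attained as soon as some p approximates f, which is always so
   for X finite and eps >= 0; otherwise it is +oo. *)
Definition approx_deg (R : realType) (N : nat) (X : set 'rV[R]_N)
    (f : 'rV[R]_N -> R) (eps : R) : \bar R :=
  ereal_inf [set ((mpoly.msize p).-1%:R)%:E | p in approximates X f eps].

Lemma approx_deg_attained (R : realType) (N : nat) (X : set 'rV[R]_N)
    (f : 'rV[R]_N -> R) (eps : R) :
  (exists p, approximates X f eps p) ->
  exists2 p, approximates X f eps p &
    approx_deg X f eps = ((mpoly.msize p).-1%:R)%:E.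
Proof.
move=> [p0 h0].
pose P d := `[< exists2 p, approximates X f eps p & (mpoly.msize p).-1 = d >].
have exP : exists d, P d.
  by exists (mpoly.msize p0).-1; apply/asboolP; exists p0.
case: (ex_minnP exP) => d /asboolP[p hp pd] dmin; exists p => //.
apply/eqP; rewrite eq_le; apply/andP; split.
  by apply: ereal_inf_lbound; exists p.
apply: le_ereal_inf_tmp => _ [q hq <-]; rewrite lee_fin ler_nat pd.
by apply: dmin; apply/asboolP; exists q.
Qed.

(* Main.v *)
Require Import Defs.
From mathcomp Require Import all_boot all_order all_algebra.
From mathcomp Require Import perm complex.
From mathcomp Require Import all_classical all_reals all_analysis.
From mathcomp Require Import zify ring lra.
From mathcomp Require mpoly.
Import -(notations) mpoly.

Set Implicit Arguments.
Unset Strict Implicit.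
Unset Printing Implicit Defensive.

Import Order.TTheory GRing.Theory Num.Theory.

Local Open Scope ring_scope.

(* Read the function at k random points and call i marked if its value occurs
   at a sampled point other than i. A permutation has no marked point; a
   function with image of size at most alpha n has, up to probability eps/2, at
   least b points among the sample that collide with another point, hence at
   least b marked points, where k and b are of order
   m = n^(1/3) log(1/eps)^(2/3).

   For the search, r Grover iterations followed by a check leave the unmarked
   part of the state unchanged up to a factor T_r(c), where c = 1 - M / n for M
   marked points (c >= 0 because an extra bit halves the marked fraction).
   By the doubling formula U_(2r-1) = 2 T_r U_(r-1), one sweep over
   r = 1, 2, 4, ..., 2^(A-1) multiplies the amplitude of a miss by
   U_(2^A-1)(c) / 2^A, whose square is at most 1 / (4^A (1 - c^2)). So
   sweeps of cost O(sqrt(n / b)) repeated O(log(1/eps)) times miss with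
   probability at most eps/2, and sqrt(n / m) log(1/eps) = m.

   The acceptance probability of an algorithm making T queries is a polynomial
   of degree at most 2T in the entries of the input matrix. *)

(** * Norm-preserving linear operators on real amplitude functions *)

Definition ket (R : pzRingType) (B : finType) (c : B) : B -> R :=
  fun b => (b == c)%:R.
Arguments ket R {B} c b.

Section Isometry.
Variables (R : realType) (B : finType).
Implicit Types (F G : (B -> R) -> B -> R) (f g u v : B -> R).

Definition l2_isometry F : Prop :=
  (forall a f g, F (fun b => a * f b + g b) = (fun b => a * F f b + F g b)) /\
  (forall f, \sum_b F f b ^+ 2 = \sum_b f b ^+ 2).

Lemma isometry_comp F G : l2_isometry F -> l2_isometry G -> l2_isometry (F \o G).
Proof.
move=> [Fl Fn] [Gl Gn]; split=> [a f g|f] /=; first by rewrite Gl Fl.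
by rewrite Fn Gn.
Qed.

Lemma isometry_id : l2_isometry id.
Proof. by split. Qed.

Lemma isometry_perm (s : B -> B) : injective s -> l2_isometry (fun f b => f (s b)).
Proof.
move=> s_inj; split=> // f.
by rewrite [RHS](reindex_inj s_inj).
Qed.

Lemma isometry_sign (p : B -> bool) :
  l2_isometry (fun f b => (-1) ^+ p b * f b).
Proof.
split=> [a f g|f]; first by apply/funext => b; ring.
by apply: eq_bigr => b _; rewrite exprMn sqrr_sign mul1r.
Qed.

(** Reflection [2 u u^T - 1] about the uniform unit vector [u]. With [k] twice the mean of [f], the
    terms [#|B| k^2] and [2 k (sum f)] cancel. *)
Lemma isometry_mean_reflection :
  l2_isometry (fun f b => 2 / #|B|%:R * (\sum_c f c) - f b).
Proof.
split=> [a f g|f].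
  by apply/funext => b; rewrite big_split /= -mulr_sumr; ring.
have [B0|Bgt0] := posnP #|B|.
  have nB : B =i pred0 by apply/card0_eq.
  by rewrite !big_pred0// => b; rewrite -[LHS]/(b \in B) nB.
have N0 : #|B|%:R != 0 :> R by rewrite pnatr_eq0 -lt0n.
have E k : \sum_b (k - f b) ^+ 2 =
    #|B|%:R * k ^+ 2 - 2 * k * (\sum_b f b) + \sum_b f b ^+ 2.
  rewrite mulr_natl -sumr_const mulr_sumr -sumrB -big_split /=.
  by apply: eq_bigr => b _; ring.
by rewrite E; field.
Qed.

(* When [u = v] the coefficient is [0 / 0 = 0] and the operator is the
   identity. *)
Definition householder u v f : B -> R := fun b =>
  f b - 2 * (\sum_c (u c - v c) * f c) / (\sum_c (u c - v c) ^+ 2) * (u b - v b).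

Lemma isometry_householder u v : l2_isometry (householder u v).
Proof.
rewrite /householder; split=> [a f g|f].
  apply/funext => b.
  under eq_bigr do rewrite mulrDr mulrCA.
  by rewrite big_split/= -mulr_sumr; ring.
set W := \sum_c (u c - v c) ^+ 2; set P := \sum_c _ * _.
have -> : \sum_b (f b - 2 * P / W * (u b - v b)) ^+ 2 =
    \sum_b f b ^+ 2 - 2 * (2 * P / W) * P + (2 * P / W) ^+ 2 * W.
  rewrite /P /W !mulr_sumr -sumrB -big_split/=; apply: eq_bigr => b _.
  by ring.
have [W0|W0] := eqVneq W 0; last by field.
by rewrite W0 invr0; ring.
Qed.

(** For unit vectors [|u - v|^2 = 2 <u - v, u>], so reflecting [u] in the hyperplane orthogonal to
    [u - v] subtracts exactly [u - v]. This prepares one state from another. *)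
Lemma householderE u v : \sum_b u b ^+ 2 = 1 -> \sum_b v b ^+ 2 = 1 ->
  householder u v u = v.
Proof.
move=> u1 v1; apply/funext => b; rewrite /householder.
set W := \sum_c (u c - v c) ^+ 2; set P := \sum_c _ * _.
have WP : W = 2 * P.
  have -> : W = \sum_c u c ^+ 2 + \sum_c v c ^+ 2 - 2 * \sum_c u c * v c.
    by rewrite /W mulr_sumr -big_split -sumrB /=; apply: eq_bigr => c _; ring.
  have -> : P = \sum_c u c ^+ 2 - \sum_c u c * v c.
    by rewrite /P -sumrB; apply: eq_bigr => c _; ring.
  by rewrite v1 u1; ring.
have [W0|W0] := eqVneq W 0; last by rewrite -WP divff // mul1r; ring.
move/eqP: (W0); rewrite /W psumr_eq0 => [/allP/(_ b)|c _]; last exact: sqr_ge0.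
rewrite mem_index_enum => /(_ isT) /=.
by rewrite sqrf_eq0 subr_eq0 => /eqP ->; ring.
Qed.

Lemma sum_ket (f : B -> R) (c : B) : \sum_b ket R c b * f b = f c.
Proof.
rewrite (bigD1 c)//= /ket eqxx mul1r big1 ?addr0// => b /negPf ->.
by rewrite mul0r.
Qed.

Lemma sum_ket_sqr (c : B) : \sum_b (ket R c b) ^+ 2 = 1 :> R.
Proof. by under eq_bigr do rewrite expr2; rewrite sum_ket /ket eqxx. Qed.

Lemma isometry_ket_expand F f b : l2_isometry F ->
  F f b = \sum_c F (ket R c) b * f c.
Proof.
move=> [Fl _].
have F0 : F (fun=> 0) = fun=> 0.
  have := Fl (-1) (fun=> 0) (fun=> 0); rewrite mulr0 addr0 => ->.
  by apply/funext => c; rewrite mulN1r addNr.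
have Fs (s : seq B) : F (fun d => \sum_(c <- s) f c * ket R c d) =
    fun d => \sum_(c <- s) F (ket R c) d * f c.
  elim: s => [|c s IH].
    by under eq_fun do rewrite big_nil; rewrite F0;
      apply/funext => d; rewrite big_nil.
  under eq_fun do rewrite big_cons.
  by rewrite Fl IH; apply/funext => d; rewrite big_cons mulrC.
transitivity (F (fun d => \sum_(c <- index_enum B) f c * ket R c d) b);
  last by rewrite Fs.
congr (F _ b); apply/funext => d.
rewrite -[LHS]sum_ket; apply: eq_bigr => c _.
by rewrite mulrC /ket eq_sym.
Qed.

Lemma isometry_dot F f g : l2_isometry F ->
  \sum_b F f b * F g b = \sum_b f b * g b.
Proof.
move=> [Fl Fn]; have := Fn (fun b => 1 * f b + g b).
have E (h k : B -> R) : \sum_b (1 * h b + k b) ^+ 2 =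
    \sum_b h b ^+ 2 + \sum_b k b ^+ 2 + 2 * \sum_b h b * k b.
  by rewrite mulr_sumr -!big_split; apply: eq_bigr => b _ /=; ring.
by rewrite Fl !E !Fn => /addrI /(mulfI (_ : 2 != 0 :> R)) ->.
Qed.

End Isometry.

(* [get] and [put] form a lens: [lens_op G] applies [G] to the component of
   [B] seen by the lens, with [G] controlled by the rest. *)
Section Lens.
Variables (R : realType) (B X : finType) (get : B -> X) (put : X -> B -> B).
Hypotheses (getK : forall x b, get (put x b) = x)
  (putK : forall b, put (get b) b = b)
  (putput : forall x y b, put x (put y b) = put x b).

Definition lens_op (G : B -> (X -> R) -> X -> R) (f : B -> R) : B -> R :=
  fun b => G b (fun x => f (put x b)) (get b).

(** The map [(b, x) -> (put x b, get b)] is an involution, so [#|X|] times a sum over [B] is the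
    double sum over [b] and [x] of the values at [put x b], and [G b] preserves each inner sum of
    squares. *)
Lemma isometry_lens G : (forall b, l2_isometry (G b)) ->
  (forall x b, G (put x b) = G b) -> l2_isometry (lens_op G).
Proof.
move=> Giso Gput; split=> [a f g|f].
  by apply/funext => b; rewrite /lens_op (Giso b).1.
have E (h : B -> R) : \sum_b \sum_x h (put x b) = #|X|%:R * \sum_b h b.
  rewrite pair_bigA /= (reindex (fun p => (put p.2 p.1, get p.1))) /=; last first.
    by apply: onW_bij; exists (fun p => (put p.2 p.1, get p.1)) => -[b x] /=;
      rewrite getK putput putK.
  rewrite mulr_sumr -(pair_bigA _ (fun b (x : X) => h (put (get b) (put x b)))).
  apply: eq_bigr => b _ /=.
  under eq_bigr do rewrite putput putK.
  by rewrite sumr_const mulr_natl.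
have [X0|Xgt0] := posnP #|X|.
  have nB (b : B) : False by have := card0_eq X0 (get b).
  by apply: eq_bigr => b _; case: (nB b).
have Xn0 : #|X|%:R != 0 :> R by rewrite pnatr_eq0 -lt0n.
apply: (mulfI Xn0); rewrite -2!E; apply: eq_bigr => b _.
under eq_bigr => x _.
  rewrite /lens_op Gput getK; under eq_fun do rewrite putput.
over.
exact: (Giso b).2.
Qed.
End Lens.

Lemma isometryZ (R : realType) (B : finType) (F : (B -> R) -> B -> R) a f :
  l2_isometry F -> F (fun b => a * f b) = (fun b => a * F f b).
Proof.
move=> Fi; apply/funext => b; rewrite !(isometry_ket_expand _ _ Fi) mulr_sumr.
by apply: eq_bigr => c _; rewrite mulrCA.
Qed.

(** * Real query algorithms, indexed by their number of queries *)

Lemma query_basis_inj n W phi : injective (@query_basis n W phi).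
Proof.
move=> [[i j] w] [[i' j'] w'] [<- /eqP + <-].
by rewrite eqn_modDr !modn_small // => /eqP/val_inj ->.
Qed.

Section RealQuery.
Variables (R : realType) (n : nat) (W : finType).
Implicit Types (phi : {ffun 'I_n -> 'I_n}).
Let B : finType := qbasis n W.

Definition query_op phi (f : B -> R) : B -> R :=
  fun b => \sum_c (b == query_basis phi c)%:R * f c.

Lemma query_opE phi f c : query_op phi f (query_basis phi c) = f c.
Proof.
rewrite /query_op -[RHS]sum_ket; apply: eq_bigr => d _.
by rewrite (inj_eq (@query_basis_inj _ _ _)) eq_sym.
Qed.

Inductive realizes :
    nat -> ({ffun 'I_n -> 'I_n} -> (B -> R) -> B -> R) -> Prop :=
| realizes0 F : l2_isometry F -> realizes 0 (fun=> F)
| realizesS T U F : l2_isometry F -> realizes T U ->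
    realizes T.+1 (fun phi => F \o query_op phi \o U phi).

(** The last isometry of [U] and the first of [U'] merge into one, so the query counts add. *)
Lemma realizes_comp T T' U U' : realizes T U -> realizes T' U' ->
  realizes (T' + T) (fun phi => U' phi \o U phi).
Proof.
move=> rU; elim=> {T' U'} [F Fi|T' U' F Fi rU' IH].
  case: rU => [G Gi|T1 U1 G Gi rU1].
    by apply: realizes0; exact: isometry_comp.
  by apply: (realizesS (isometry_comp Fi Gi)).
exact: (realizesS Fi IH).
Qed.

Lemma realizes_iter T U r : realizes T U ->
  realizes (r * T) (fun phi => iter r (U phi)).
Proof.
move=> rU; elim: r => [|r IH]; first exact: (realizes0 (@isometry_id _ _)).
exact: realizes_comp IH rU.
Qed.

Fixpoint run (F : nat -> (B -> R) -> B -> R) phi t (f : B -> R) : B -> R :=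
  if t is t'.+1 then F t (query_op phi (run F phi t' f)) else F 0%N f.

Lemma realizes_run T U : realizes T U ->
  exists F, (forall t, l2_isometry (F t)) /\ (forall phi f, U phi f = run F phi T f).
Proof.
elim=> {T U} [F Fi|T U F Fi rU [G [Gi GE]]]; first by exists (fun=> F).
exists (fun t => if t == T.+1 then F else G t); split=> [t|phi f].
  by case: ifP.
rewrite /= eqxx; congr F; congr query_op; rewrite GE.
suff E t : (t <= T)%N ->
  run G phi t f = run (fun t => if t == T.+1 then F else G t) phi t f by exact: E.
elim: t => [|t IH] tT //=; rewrite eqSS ltn_eqF //.
by rewrite -IH // ltnW.
Qed.
End RealQuery.

(** * From real isometries to complex unitary matrices *)

Definition op_mx (R : realType) (B : finType) (F : (B -> R) -> B -> R) :
    'M[R[i]]_#|B| :=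
  \matrix_(r, c) (F (ket R (enum_val c)) (enum_val r))%:C%C.

Lemma sum_enum_val (V : nmodType) (B : finType) (h : B -> V) :
  \sum_(r < #|B|) h (enum_val r) = \sum_b h b.
Proof. by rewrite [RHS](reindex _ (onW_bij _ (@enum_val_bij B))). Qed.

(** The entries are real, so the adjoint is the transpose, and the columns are orthonormal because
    [F] preserves inner products. *)
Lemma op_mx_unitary (R : realType) (B : finType) (F : (B -> R) -> B -> R) :
  l2_isometry F -> op_mx F \is unitarymx.
Proof.
move=> Fi; apply/unitarymxP/mulmx1C/matrixP => r c; rewrite !mxE.
under eq_bigr => k _.
  rewrite !mxE [X in X * _](_ : _ = (F (ket R (enum_val r)) (enum_val k))%:C%C);
    last first.
    by apply/eqP; rewrite eq_complex /= oppr0 !eqxx.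
  rewrite -rmorphM /=. over.
rewrite -rmorph_sum /= (sum_enum_val (fun b => F _ b * F _ b)).
rewrite (isometry_dot _ _ Fi) sum_ket /ket (inj_eq enum_val_inj).
by rewrite -(rmorph_nat (real_complex R)).
Qed.

Definition state_col (R : realType) (B : finType) (f : B -> R) :
  'cV[R[i]]_#|B| := \col_r (f (enum_val r))%:C%C.

Lemma op_mx_state (R : realType) (B : finType) (F : (B -> R) -> B -> R) f :
  l2_isometry F -> op_mx F *m state_col f = state_col (F f).
Proof.
move=> Fi; apply/matrixP => r c; rewrite !mxE.
under eq_bigr do rewrite !mxE -rmorphM /=.
rewrite -rmorph_sum /= (sum_enum_val (fun b => F (ket R b) _ * f b)).
by rewrite -isometry_ket_expand.
Qed.

Lemma query_mx_state (R : realType) n W phi (f : qbasis n W -> R) :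
  query_mx R W phi *m state_col f = state_col (query_op phi f).
Proof.
apply/matrixP => r c; rewrite !mxE.
under eq_bigr do rewrite !mxE -(rmorph_nat (real_complex R)) -rmorphM /=.
by rewrite -rmorph_sum /= (sum_enum_val (fun b => (_ == query_basis phi b)%:R * f b)).
Qed.

(** * Random choice among query algorithms *)

Section Mixture.
Variables (R : realType) (n : nat) (W S : finType).
Let B : finType := qbasis n W.
Let BS : finType := qbasis n (W * S)%type.

Let get (b : BS) : B := (b.1, b.2.1).
Let seed (b : BS) : S := b.2.2.
Let put (x : B) (b : BS) : BS := (x.1, (x.2, seed b)).

Let getK x b : get (put x b) = x. Proof. by case: x. Qed.
Let putK b : put (get b) b = b. Proof. by case: b => ij []. Qed.
Let putput x y b : put x (put y b) = put x b. Proof. by []. Qed.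

Let sum_seed (V : nmodType) (h : BS -> V) (P : pred B) :
  \sum_(b | P (get b)) h b = \sum_s \sum_(x | P x) h (x.1, (x.2, s)).
Proof.
rewrite exchange_big /= pair_big_dep /=.
rewrite (reindex (fun p : B * S => (p.1.1, (p.1.2, p.2)) : BS)) /=.
  by apply: eq_bigl => -[[ij w] s]; rewrite andbT.
by apply: onW_bij; exists (fun b => (get b, seed b)) => [[[ij w] s]|[ij [w s]]].
Qed.

Let query_seed phi (a : R) (g : S -> B -> R) (b : BS) :
  query_op phi (fun c => a * g (seed c) (get c)) b =
  a * query_op phi (g (seed b)) (get b).
Proof.
have /codomP[c ->] : b \in codom (query_basis phi).
  by apply: (inj_card_onto (@query_basis_inj _ _ _)).
have -> : get (query_basis phi c) = query_basis phi (get c).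
  by case: c => -[i j] [w s].
by rewrite !query_opE; case: c => -[i j] [w s].
Qed.

(* A classical random seed is a control register prepared in the uniform
   superposition and never modified. *)
Lemma mixture (T : nat) (U : S -> {ffun 'I_n -> 'I_n} -> (B -> R) -> B -> R)
    (b0 : B) (s0 : S) (out : B -> bool) :
  (forall s, realizes T (U s)) ->
  exists A : query_algorithm R n, qcost A = T /\
    forall phi v, prob_output A phi v =
      #|S|%:R^-1 * \sum_s \sum_(b | out b == v) U s phi (ket R b0) b ^+ 2.
Proof.
move=> rU; have [F FP] := choice (fun s => realizes_run (rU s)).
pose N : R := #|S|%:R.
have N0 : 0 < N by rewrite ltr0n; apply/card_gt0P; exists s0.
(* Amplitude of each seed; [u] below is the uniform superposition of the seeds over [b0]. *)
pose a := Num.sqrt N^-1.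
have a2 : a ^+ 2 = N^-1 by rewrite sqr_sqrtr// invr_ge0 ltW.
pose u (b : BS) := a * ket R b0 (get b).
pose i0 : BS := put b0 (b0.1, (b0.2, s0)).
have u1 : \sum_b u b ^+ 2 = 1.
  rewrite (sum_seed _ predT); under eq_bigr => s _.
    under eq_bigr => x _ do rewrite /u -[get _]/(x.1, x.2) -surjective_pairing exprMn.
    rewrite -mulr_sumr sum_ket_sqr mulr1 a2. over.
  by rewrite sumr_const -[_ *+ _]mulr_natl mulfV // gt_eqF.
pose L t := lens_op (R := R) get put (fun b => F (seed b) t).
have Li t : l2_isometry (L t).
  by apply: isometry_lens => // b; exact: (FP _).1.
(* Seed preparation is absorbed in the first unitary and costs no query. *)
pose G t := if t is 0 then L 0 \o householder (ket R i0) u else L t.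
have Gi t : l2_isometry (G t).
  case: t => [|t] /=; last exact: Li.
  by apply: isometry_comp => //; exact: isometry_householder.
pose A := @QueryAlgorithm R n (W * S)%type T i0 (fun t => op_mx (G t))
  (fun t => op_mx_unitary (Gi t)) (fun b => out (get b)).
have L_E t g : L t (fun b => a * g (seed b) (get b)) =
    fun b => a * F (seed b) t (g (seed b)) (get b).
  apply/funext => b; rewrite /L /lens_op.
  have /(congr1 (@^~ (get b))) /= <- :=
    isometryZ a (g (seed b)) ((FP (seed b)).1 t).
  congr (F _ _ _ _).
  by apply/funext => x; rewrite getK.
(* Invariant: the block of a seed holds [a] times the state of that seed's own algorithm. *)
have stE phi t : qstate A phi t =
    state_col (fun b => a * run (F (seed b)) phi t (ket R b0) (get b)).
  elim: t => [|t IH].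
    transitivity (op_mx (G 0) *m state_col (ket R i0)).
      rewrite /=; congr (_ *m _); apply/matrixP => r c.
      rewrite !mxE ord1 eqxx andbT /ket -(rmorph_nat (real_complex R)) /=.
      by rewrite -(inj_eq enum_val_inj) enum_rankK.
    rewrite op_mx_state // /G /= householderE ?sum_ket_sqr // /u.
    by rewrite (L_E 0%N (fun=> ket R b0)).
  rewrite [LHS]/= IH query_mx_state op_mx_state; last exact: Li.
  pose g s := run (F s) phi t (ket R b0).
  have /funext -> := query_seed phi a g : _ =1 fun b => _.
  by rewrite (L_E t.+1 (fun s => query_op phi (run (F s) phi t (ket R b0)))).
exists A; split=> // phi v; rewrite /prob_output stE /=.
under eq_bigr => b _.
  rewrite mxE enum_rankK /Normc.normc /= expr0n addr0 sqr_sqrtr ?sqr_ge0 //.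
  rewrite exprMn a2. over.
rewrite (sum_seed _ (fun b => out b == v)) mulr_sumr; apply: eq_bigr => s _.
rewrite mulr_sumr; apply: eq_bigr => x _.
by rewrite (FP s).2 /get /= -surjective_pairing.
Qed.
End Mixture.

(** * Norm preservation: the output probabilities sum to one *)

Lemma normc_sqr (R : rcfType) (z : R[i]) :
  Normc.normc z ^+ 2 = complex.Re z ^+ 2 + complex.Im z ^+ 2.
Proof. by case: z => a b /=; rewrite sqr_sqrtr // addr_ge0 ?sqr_ge0. Qed.

Lemma ReM (R : rcfType) (y z : R[i]) :
  complex.Re (y * z) = complex.Re y * complex.Re z - complex.Im y * complex.Im z.
Proof. by case: y; case: z. Qed.

Lemma ImM (R : rcfType) (y z : R[i]) :
  complex.Im (y * z) = complex.Re y * complex.Im z + complex.Im y * complex.Re z.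
Proof. by case: y; case: z => *. Qed.

Lemma unitary_norm (R : realType) m (U : 'M[R[i]]_m) (v : 'cV[R[i]]_m) :
  U \is unitarymx ->
  \sum_r Normc.normc ((U *m v) r ord0) ^+ 2 = \sum_r Normc.normc (v r ord0) ^+ 2.
Proof.
have E (w : 'cV[R[i]]_m) :
    ((w ^t*)%sesqui *m w) ord0 ord0 = (\sum_r Normc.normc (w r ord0) ^+ 2)%:C%C.
  rewrite mxE rmorph_sum /=; apply: eq_bigr => r _; rewrite !mxE.
  by rewrite mulrC -sqr_normc rmorphXn.
move=> /unitarymxP/mulmx1C UU; apply: (@complexI R); rewrite -!E.
by rewrite trmx_mul map_mxM mulmxA -(mulmxA ((v ^t*)%sesqui)) UU mulmx1.
Qed.

Lemma query_mx_norm (R : realType) n W phi (v : 'cV[R[i]]_#|qbasis n W|) :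
  \sum_r Normc.normc ((query_mx R W phi *m v) r ord0) ^+ 2 =
  \sum_r Normc.normc (v r ord0) ^+ 2.
Proof.
pose s (c : 'I_#|qbasis n W|) := enum_rank (query_basis phi (enum_val c)).
have s_inj : injective s.
  by move=> c d /enum_rank_inj/query_basis_inj/enum_val_inj.
rewrite (reindex_inj s_inj); apply: eq_bigr => c _; congr (Normc.normc _ ^+ 2).
rewrite mxE (bigD1 c) //= big1 ?addr0 => [|d dc]; rewrite mxE enum_rankK.
  by rewrite eqxx mul1r.
rewrite (inj_eq (@query_basis_inj _ _ _)) (inj_eq enum_val_inj) eq_sym.
by rewrite (negPf dc) mul0r.
Qed.

Lemma prob_output_sum (R : realType) n (A : query_algorithm R n) phi :
  prob_output A phi true + prob_output A phi false = 1.
Proof.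
have st t : \sum_r Normc.normc (qstate A phi t r ord0) ^+ 2 = 1.
  elim: t => [|t IH] /=; rewrite unitary_norm ?qstep_unitary ?query_mx_norm //.
  rewrite (bigD1 (enum_rank (qinit A))) //= mxE !eqxx big1 ?addr0.
    by rewrite normc_sqr /= expr1n expr0n addr0.
  by move=> r /negPf rb; rewrite mxE rb normc_sqr /= expr0n addr0.
rewrite -[RHS](st (qcost A)) (reindex _ (onW_bij _ (@enum_rank_bij _))) /=.
rewrite [RHS](bigID (fun b => qout A b)) /=; congr (_ + _).
  by apply: eq_bigl => b; rewrite eqb_id.
by apply: eq_bigl => b; rewrite eqbF_neg.
Qed.

Lemma prob_output_ge0 (R : realType) n (A : query_algorithm R n) phi v :
  0 <= prob_output A phi v.
Proof. by apply: sumr_ge0 => b _; exact: sqr_ge0. Qed.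

(** * The polynomial method *)

Section PolynomialMethod.
Variables (R : realType) (n : nat).
Implicit Types (h : {ffun 'I_n -> 'I_n} -> R) (phi : {ffun 'I_n -> 'I_n}).

(** [msize] is the total degree plus one, and 0 for the zero polynomial, so the bound means degree
    at most [d]. *)
Definition poly_fun (d : nat) h : Prop :=
  exists p : mpoly (n * n) R, (msize p <= d.+1)%N /\
    forall phi, meval (fun k => ptp_point R phi ord0 k) p = h phi.

Lemma poly_fun_cst d a : poly_fun d (fun=> a).
Proof.
exists (mpolyC (n * n) a); split=> [|phi]; last by rewrite mevalC.
by rewrite msizeC; case: (a != 0).
Qed.

Lemma poly_fun_entry i j : poly_fun 1 (fun phi => (phi i == j)%:R).
Proof.
exists (mpolyX R (mnm1 (mxvec_index i j))); split=> [|phi].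
  by rewrite msizeX mdeg1.
by rewrite mevalXU /ptp_point mxvecE mxE.
Qed.

Lemma poly_funD d h h' : poly_fun d h -> poly_fun d h' ->
  poly_fun d (fun phi => h phi + h' phi).
Proof.
move=> [p [pd pE]] [q [qd qE]]; exists (p + q); split=> [|phi].
  by rewrite (leq_trans (msizeD_le _ _)) // geq_max pd.
by rewrite mevalD pE qE.
Qed.

Lemma poly_funM d d' h h' : poly_fun d h -> poly_fun d' h' ->
  poly_fun (d + d') (fun phi => h phi * h' phi).
Proof.
move=> [p [pd pE]] [q [qd qE]]; exists (p * q); split=> [|phi]; last first.
  by rewrite mevalM pE qE.
have [->|p0] := eqVneq p 0; first by rewrite mul0r msize0.
have [->|q0] := eqVneq q 0; first by rewrite mulr0 msize0.
rewrite msizeM // -ltnS prednK ?ltnS; last first.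
  by rewrite addn_gt0 lt0n msize_poly_eq0 p0.
by rewrite -addSn -addnS leq_add.
Qed.

Lemma poly_funZ d a h : poly_fun d h -> poly_fun d (fun phi => a * h phi).
Proof. exact: (poly_funM (poly_fun_cst 0 a)). Qed.

Lemma poly_fun_sum d (I : Type) (r : seq I) (P : pred I) (h : I -> _ -> R) :
  (forall i, P i -> poly_fun d (h i)) ->
  poly_fun d (fun phi => \sum_(i <- r | P i) h i phi).
Proof.
move=> hP; elim: r => [|i r IH].
  by under eq_fun do rewrite big_nil; exact: poly_fun_cst.
under eq_fun do rewrite big_cons.
by case: (boolP (P i)) => [Pi|_] //; apply: poly_funD => //; exact: hP.
Qed.

(** The image of a basis state depends on [phi] only through one value [phi i]; expanding over this
    value gives a linear form in the input matrix. *)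
Lemma query_mx_poly W (r c : 'I_#|qbasis n W|) :
  poly_fun 1 (fun phi => (enum_val r == query_basis phi (enum_val c))%:R).
Proof.
case: (enum_val c) => -[i j] w.
have -> : (fun phi => (enum_val r == query_basis phi (i, j, w))%:R : R) =
    fun phi => \sum_v (enum_val r == (i, addmod j v, w))%:R * (phi i == v)%:R.
  apply/funext => phi; rewrite (bigD1 (phi i)) //= eqxx mulr1 big1 ?addr0 // => v.
  by rewrite eq_sym => /negPf ->; rewrite mulr0.
by apply: poly_fun_sum => v _; exact/poly_funZ/poly_fun_entry.
Qed.

(** Query entries have degree 1 and the other unitaries are constant in [phi], so a query raises the
    degree by at most one. Real and imaginary parts are followed separately to obtain real
    polynomials. *)
Lemma qstate_poly (A : query_algorithm R n) t r :
  poly_fun t (fun phi => complex.Re (qstate A phi t r ord0)) /\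
  poly_fun t (fun phi => complex.Im (qstate A phi t r ord0)).
Proof.
have Re_sum (I : finType) (f : I -> R[i]) :
    complex.Re (\sum_i f i) = \sum_i complex.Re (f i) by rewrite raddf_sum.
have Im_sum (I : finType) (f : I -> R[i]) :
    complex.Im (\sum_i f i) = \sum_i complex.Im (f i) by rewrite raddf_sum.
have unitary_step (U : 'M[R[i]]_#|qbasis n (qwork A)|)
      (v : {ffun 'I_n -> 'I_n} -> 'cV[R[i]]_#|qbasis n (qwork A)|) d r' :
    (forall c, poly_fun d (fun phi => complex.Re (v phi c ord0)) /\
               poly_fun d (fun phi => complex.Im (v phi c ord0))) ->
    poly_fun d (fun phi => complex.Re ((U *m v phi) r' ord0)) /\
    poly_fun d (fun phi => complex.Im ((U *m v phi) r' ord0)).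
  move=> vP; split.
    under eq_fun do rewrite mxE Re_sum.
    apply: poly_fun_sum => c _; under eq_fun do rewrite ReM -mulNr.
    by apply: poly_funD; apply: poly_funZ; case: (vP c).
  under eq_fun do rewrite mxE Im_sum.
  apply: poly_fun_sum => c _; under eq_fun do rewrite ImM.
  by apply: poly_funD; apply: poly_funZ; case: (vP c).
elim: t r => [|t IH] r; first by split; exact: poly_fun_cst.
apply: (unitary_step (qstep A t.+1)
  (fun phi => query_mx R (qwork A) phi *m qstate A phi t)) => c.
have entryE phi d : query_mx R (qwork A) phi c d =
    ((enum_val c == query_basis phi (enum_val d))%:R : R)%:C%C.
  by rewrite mxE -(rmorph_nat (real_complex R)).
split.
  under eq_fun do rewrite mxE Re_sum.
  apply: poly_fun_sum => d _.
  under eq_fun do rewrite entryE ReM /= mul0r subr0.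
  exact: (poly_funM (query_mx_poly c d) (IH d).1).
under eq_fun do rewrite mxE Im_sum.
apply: poly_fun_sum => d _.
under eq_fun do rewrite entryE ImM /= mul0r addr0.
exact: (poly_funM (query_mx_poly c d) (IH d).2).

Qed.

Lemma prob_output_poly (A : query_algorithm R n) v :
  poly_fun (2 * qcost A) (fun phi => prob_output A phi v).
Proof.
rewrite /prob_output; apply: poly_fun_sum => b _.
have [Rp Ip] := @qstate_poly A (qcost A) (enum_rank b).
under eq_fun do rewrite normc_sqr !expr2.
by rewrite mul2n -addnn; apply: poly_funD; exact: poly_funM.
Qed.
End PolynomialMethod.

(* The r-th pair is (T_r c, U_(r-1) c) for the Chebyshev polynomials of both
   kinds. *)
Fixpoint cheb (R : pzRingType) (c : R) (r : nat) : R * R :=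
  if r is r'.+1 then
    let: (x, u) := cheb c r' in (c * x - (1 - c ^+ 2) * u, x + c * u)
  else (1, 0).

(** * Identities for Chebyshev polynomials *)

Section Chebyshev.
Variables (R : realFieldType) (c : R).

Lemma chebS r : cheb c r.+1 =
  (c * (cheb c r).1 - (1 - c ^+ 2) * (cheb c r).2,
   (cheb c r).1 + c * (cheb c r).2).
Proof. by rewrite /=; case: (cheb c r). Qed.

(** With [c = cos t] the pair is [(cos (r t), sin (r t) / sin t)], and these are the addition
    formulas. *)
Lemma chebD r s : cheb c (r + s) =
  ((cheb c r).1 * (cheb c s).1 - (1 - c ^+ 2) * (cheb c r).2 * (cheb c s).2,
   (cheb c r).1 * (cheb c s).2 + (cheb c r).2 * (cheb c s).1).
Proof.
elim: r => [|r IH].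
  by rewrite add0n /=; case: (cheb c s) => x u /=; congr pair; ring.
by rewrite addSn !chebS IH /=; congr pair; ring.
Qed.

Lemma cheb_sqr r : (cheb c r).1 ^+ 2 + (1 - c ^+ 2) * (cheb c r).2 ^+ 2 = 1.
Proof.
elim: r => [|r IH]; first by rewrite /=; ring.
by rewrite chebS /= -[RHS]IH; ring.
Qed.

Lemma cheb_prod_expn A :
  (cheb c (2 ^ A)).2 = 2 ^+ A * \prod_(a < A) (cheb c (2 ^ a)).1.
Proof.
elim: A => [|A IH]; first by rewrite big_ord0 /=; ring.
by rewrite expnS mul2n -addnn chebD big_ord_recr /= IH exprS; ring.
Qed.

Lemma cheb_prod_bound A :
  4 ^+ A * (1 - c ^+ 2) * (\prod_(a < A) (cheb c (2 ^ a)).1) ^+ 2 <= 1.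
Proof.
rewrite -[leRHS](cheb_sqr (2 ^ A)) cheb_prod_expn exprMn.
have -> : 4 ^+ A = (2 ^+ A) ^+ 2 :> R by rewrite -exprM mulnC exprM; congr (_ ^+ _); ring.
by rewrite -subr_ge0 [X in 0 <= X](_ : _ = (cheb c (2 ^ A)).1 ^+ 2) ?sqr_ge0//; ring.
Qed.

End Chebyshev.

Lemma cheb_one (R : realFieldType) r : (cheb (1 : R) r).1 = 1.
Proof. by elim: r => // r IH; rewrite chebS /= IH; ring. Qed.

(** * A random sample hits a large set often *)

Section Sampling.
Variables (R : realType) (n : nat).
Implicit Types (D E : {set 'I_n}).

Lemma big_tuple_cons (T : finType) k (F : k.+1.-tuple T -> R) :
  \sum_s F s = \sum_x \sum_(s : k.-tuple T) F (cons_tuple x s).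
Proof.
rewrite pair_bigA /= (reindex (fun p => cons_tuple p.1 p.2)) //=.
exists (fun s => (thead s, behead_tuple s)) => [[x s] _|s _] /=.
  by congr pair; apply/val_inj.
by rewrite [RHS]tuple_eta.
Qed.

(** Exponential potential cut off at [b]: once [b] elements are seen a fresh draw may be unlikely,
    but the potential is already zero. *)
Definition expN_below (b : R) (x : nat) : R := (x%:R < b :> R)%R%:R * expR (- x%:R).

(* A fresh element of [D] is drawn with probability at least [q] as long as
   fewer than [b] have been seen, so the expectation of [expN_below b] of their
   number shrinks at every draw. *)
Lemma sum_expN_below (D : {set 'I_n}) (b q : R) k E :
  q * n%:R + b <= #|D|%:R -> 0 <= q <= 1 ->
  \sum_(s : k.-tuple 'I_n) expN_below b #|D :&: (E :|: [set x in s])|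
    <= (n%:R * expR (- (q / 2))) ^+ k * expN_below b #|D :&: E|.
Proof.
move=> Dq q01; set h := expN_below b.
have h_ge0 x : 0 <= h x by rewrite mulr_ge0 ?ler0n ?expR_ge0.
have h_mono x y : (x <= y)%N -> h y <= h x.
  move=> xy; rewrite /h; have xy' : x%:R <= y%:R :> R by rewrite ler_nat.
  apply: ler_pM; rewrite ?ler0n ?expR_ge0 ?ler_nat ?ler_expR ?lerN2 //.
  by case: ltrP => // /(le_lt_trans xy') ->.
have h_next x : h x.+1 <= h x / 2.
  have e2 : expR (-1) <= 2^-1 :> R.
    by rewrite expRN lef_pV2 ?posrE ?expR_gt0 //; have := expR_ge1Dx (1 : R); lra.
  rewrite /h /expN_below -natr1 opprD expRD -[leRHS]mulrA.
  apply: ler_pM; rewrite ?ler0n ?mulr_ge0 ?expR_ge0 ?ler_nat //; last first.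
    by rewrite ler_wpM2l ?expR_ge0.
  by case: (ltrP _ b) => // /(le_lt_trans _) ->//; rewrite natr1 ler_nat.
elim: k E => [|k IH] E.
  rewrite expr0 mul1r (eq_bigr (fun=> h #|D :&: E|)) => [|s _].
    by rewrite sumr_const card_tuple expn0 mulr1n.
  rewrite tuple0; congr (h #|pred_of_set (_ :&: _)|).
  by apply/setP => x; rewrite !inE orbF.
rewrite big_tuple_cons.
apply: (@le_trans _ _ (\sum_x (n%:R * expR (- (q / 2))) ^+ k * h #|D :&: (x |: E)|)).
  apply: ler_sum => x _; apply: le_trans (IH _).
  rewrite le_eqVlt; apply/orP; left; apply/eqP; apply: eq_bigr => s _.
  congr (h #|pred_of_set (_ :&: _)|).
  by apply/setP => y; rewrite !inE orbCA orbA.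
rewrite -mulr_sumr exprSr -mulrA ler_wpM2l ?exprn_ge0 ?mulr_ge0 ?expR_ge0 //.
have [xb|xb] := ltrP #|D :&: E|%:R b; last first.
  have -> : h #|D :&: E| = 0 by rewrite /h /expN_below ltNge xb mul0r.
  rewrite mulr0 big1// => x _.
  apply/eqP; rewrite eq_le h_ge0 andbT; apply: le_trans (h_mono #|D :&: E| _ _) _.
    by rewrite subset_leq_card // finset.setIS // finset.subsetUr.
  by rewrite /h /expN_below ltNge xb mul0r.
set H := h #|D :&: E|.
(* A fresh draw at least halves the potential; any other does not increase it. *)
have step x : h #|D :&: (x |: E)| <= H - (x \in D :\: E)%:R * (H / 2).
  case: (boolP (x \in _)) => [|_]; last first.
    by rewrite mul0r subr0 h_mono// subset_leq_card// finset.setIS// finset.subsetUr.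
  rewrite inE => /andP[xE xD].
  have -> : D :&: (x |: E) = x |: (D :&: E).
    by apply/setP => y; rewrite !inE; case: eqVneq => // ->; rewrite xD.
  rewrite cardsU1 inE xD (negPf xE) /= add1n mul1r.
  by apply: le_trans (h_next _) _; rewrite /H; lra.
apply: le_trans (ler_sum _ (fun x _ => step x)) _.
rewrite sumrB sumr_const -mulr_suml -natr_sum -big_mkcond /= sum1_card.
rewrite card_ord -[H *+ n]mulr_natl.
(* Fewer than [b] elements of [D] lie in [E], so at least [q n] draws are fresh. *)
have DE : q * n%:R <= #|D :\: E|%:R.
  have : #|D|%:R = #|D :&: E|%:R + #|D :\: E|%:R :> R by rewrite -natrD cardsID.
  lra.
have : 1 - q / 2 <= expR (- (q / 2)) by rewrite expR_ge1Dx.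
move=> eq.
have H0 : 0 <= H by exact: h_ge0.
apply: (@le_trans _ _ (n%:R * (1 - q / 2) * H)).
  have : 0 <= (#|D :\: E|%:R - q * n%:R) * H by rewrite mulr_ge0 // subr_ge0.
  lra.
by rewrite ler_wpM2r// ler_wpM2l.
Qed.

End Sampling.

(** Markov's inequality: where the count is below [b], the potential is at least [exp (- b)]. *)
Lemma card_few_hits (R : realType) (n : nat) (D : {set 'I_n}) (b q : R) k :
  0 <= b -> q * n%:R + b <= #|D|%:R -> 0 <= q <= 1 ->
  \sum_(s : k.-tuple 'I_n) (#|D :&: [set x in s]|%:R < b)%R%:R
    <= n%:R ^+ k * expR (b - k%:R * (q / 2)) :> R.
Proof.
move=> b0 Dq q01.
have := sum_expN_below k finset.set0 Dq q01.
under eq_bigr do rewrite finset.set0U.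
rewrite finset.setI0 cards0 exprMn -expRM_natl mulrN => le.
have le' : n%:R ^+ k * expR (- (k%:R * (q / 2))) * expN_below b 0 <=
    n%:R ^+ k * expR (- (k%:R * (q / 2))).
  rewrite ler_piMr ?mulr_ge0 ?exprn_ge0 ?expR_ge0 // /expN_below oppr0 expR0 mulr1.
  by case: (_ < b).
rewrite expRD mulrCA mulrC -ler_pdivrMr ?expR_gt0 //.
apply: le_trans (le_trans le le'); rewrite mulr_suml; apply: ler_sum => s _.
rewrite -expRN /expN_below; case: ltP => [xb|_]; last by rewrite !mul0r.
by rewrite !mul1r ler_expR lerN2 ltW.
Qed.

(** * Collisions, and the partners of sampled points *)

Lemma next_neq (T : eqType) (c : seq T) x y :
  uniq c -> x \in c -> y \in c -> y != x -> next c x != x.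
Proof.
move=> Uc xc yc yx; have [k p pE] := rot_to xc.
have Up : uniq (x :: p) by rewrite -pE rot_uniq.
have : y \in x :: p by rewrite -pE mem_rot.
rewrite inE (negPf yx) /=; rewrite -(next_rot k Uc) pE.
case: p {pE} Up => //= z p; rewrite eqxx inE negb_or eq_sym.
by case/andP => /andP[].
Qed.

Section Collisions.
Variables (T : finType) (T' : eqType) (phi : T -> T').

Definition colliding : {set T} :=
  [set i | [exists j, (j != i) && (phi j == phi i)]].

(** Cyclic successor inside the fibre of [i]: a permutation of [T] that preserves [phi] and moves
    every colliding point. *)
Definition next_colliding (i : T) : T :=
  next (enum [pred j | phi j == phi i]) i.

Lemma next_colliding_phi i : phi (next_colliding i) = phi i.
Proof.
have : next_colliding i \in enum [pred j | phi j == phi i].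
  by rewrite mem_next mem_enum inE.
by rewrite mem_enum inE => /eqP.
Qed.

Lemma next_colliding_neq i : i \in colliding -> next_colliding i != i.
Proof.
rewrite inE => /existsP[j /andP[ji pji]].
by apply: (@next_neq _ _ _ j); rewrite ?enum_uniq ?mem_enum ?inE.
Qed.

Lemma next_colliding_inj : injective next_colliding.
Proof.
move=> i j ij.
have pij : phi i = phi j by rewrite -next_colliding_phi ij next_colliding_phi.
move: ij; rewrite /next_colliding pij; apply: can_inj; apply: prev_next.
exact: enum_uniq.
Qed.

Definition partners (S : pred T) : {set T} :=
  [set i | [exists j, [&& S j, j != i & phi j == phi i]]].

(** Each colliding sampled point makes its successor in the fibre a partner, and the successor map
    is injective. *)
Lemma leq_card_partners (S : pred T) :
  (#|colliding :&: [set j | S j]| <= #|partners S|)%N.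
Proof.
rewrite -(card_imset _ next_colliding_inj); apply: subset_leq_card.
apply/fintype.subsetP => _ /imsetP[i + ->]; rewrite inE => /andP[ic]; rewrite inE => Si.
rewrite inE; apply/existsP; exists i.
by rewrite Si eq_sym next_colliding_neq //= next_colliding_phi.
Qed.
End Collisions.

(** [phi] is injective on the points that do not collide, so these are no more numerous than the
    image. *)
Lemma card_colliding (T T' : finType) (phi : T -> T') :
  (#|T| <= #|colliding phi| + #|codom phi|)%N.
Proof.
rewrite -(cardsC (colliding phi)) leq_add2l.
rewrite -(card_in_imset (_ : {in ~: colliding phi &, injective phi})).
  apply: subset_leq_card; apply/fintype.subsetP => _ /imsetP[i _ ->].
  exact: codom_f.
move=> i j _; rewrite !inE negb_exists => /forallP/(_ i) + ij.
by rewrite ij eqxx andbT negbK => /eqP.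
Qed.

Lemma partners_inj (T : finType) (T' : eqType) (phi : T -> T') S :
  injective phi -> partners phi S = finset.set0.
Proof.
move=> phi_inj; apply/setP => i; rewrite !inE; apply/existsP => -[j].
by case/and3P => _ ji /eqP/phi_inj/eqP; rewrite (negPf ji).
Qed.

(** * Grover search for the partners of a sample *)

Lemma perm_ket (R : pzRingType) (B : finType) (s : B -> B) b b' :
  injective s -> s b' = b -> (fun d => ket R b (s d)) = ket R b'.
Proof. by move=> s_inj <-; apply/funext => d; rewrite /ket inj_eq. Qed.

Section Search.
Variables (R : realType) (n' k N : nat).
Notation n := n'.+1.
Implicit Types (phi : {ffun 'I_n -> 'I_n}) (t : {ffun 'I_k -> 'I_n}).

(* A table of answers, the bit halving the fraction of marked states, and the
   index of the check that caught the state (0 if none did). *)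
Let W : finType := ({ffun 'I_k -> 'I_n} * bool * 'I_N.+1)%type.
Let B : finType := qbasis n W.

Lemma query_basisE phi i j (w : W) :
  query_basis phi (i, j, w) = (i, j + phi i, w).
Proof. by congr (_, _, _); apply: val_inj. Qed.

Lemma query_op_subE phi (f : B -> R) i j w :
  query_op phi f (i, j, w) = f (i, j - phi i, w).
Proof. by have := query_opE phi f (i, j - phi i, w); rewrite query_basisE subrK. Qed.

Definition unquery_op phi (f : B -> R) : B -> R := fun b => f (query_basis phi b).

(** Negating the answer register before and after a query inverts it, so computing [phi i], applying
    [F] and uncomputing costs two queries. *)
Lemma realizes_conj F : l2_isometry F ->
  realizes 2 (fun phi => unquery_op phi \o F \o query_op phi).
Proof.
move=> Fi; pose neg (b : B) : B := let: (i, j, w) := b in (i, - j, w).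
have negi : l2_isometry (fun (f : B -> R) b => f (neg b)).
  by apply/isometry_perm/inv_inj => -[[i j] w]; rewrite /= opprK.
have := realizesS negi (realizesS (isometry_comp negi Fi)
  (realizes0 (@isometry_id R B))).
congr (realizes _ _); apply/funext => phi; apply/funext => f.
apply/funext => -[[i j] w]; rewrite /comp /unquery_op query_basisE /=.
by rewrite query_op_subE /= opprD !opprK.
Qed.

Variable s : 'I_k -> 'I_n.

Definition table phi : {ffun 'I_k -> 'I_n} := [ffun l => phi (s l)].

(** The test [s l != i] keeps a sampled point from matching its own table entry. *)
Definition match_table t (i v : 'I_n) : bool :=
  [exists l, (s l != i) && (t l == v)].

Definition marked phi (x : 'I_n * bool) : bool :=
  x.2 && match_table (table phi) x.1 (phi x.1).

Definition upd t (l : 'I_k) (v : 'I_n) : {ffun 'I_k -> 'I_n} :=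
  [ffun m => if m == l then v else t m].

(** Operators pull functions back, so this is the inverse of the physical step: shift the index by
    [s l], query, swap the answer with cell [l], shift back. *)
Definition load_basis l phi (b : B) : B :=
  let: (i, j, (t, e, c)) := b in (i, t l - phi (i + s l), (upd t l j, e, c)).

Definition load_op l phi (f : B -> R) : B -> R := fun b => f (load_basis l phi b).

Lemma load_basis_inj l phi : injective (load_basis l phi).
Proof.
move=> [[i j] [[t e] c]] [[i' j'] [[t' e'] c']] E.
have /= tl := congr1 (fun b : B => b.1.2) E.
case: E tl => <- _ /ffunP tt <- <- /addIr tl.
congr (_, _, (_, _, _)); first by have := tt l; rewrite !ffunE eqxx.
apply/ffunP => m; have [->//|ml] := eqVneq m l.
by have := tt m; rewrite !ffunE (negPf ml).
Qed.

Lemma realizes_load l : realizes 1 (load_op l).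
Proof.
pose sub (b : B) : B := let: (i, j, w) := b in (i - s l, j, w).
pose add (b : B) : B := let: (i, j, w) := b in (i + s l, j, w).
pose swap (b : B) : B :=
  let: (i, j, (t, e, c)) := b in (i, t l, (upd t l j, e, c)).
have swapK : involutive swap.
  move=> [[i j] [[t e] c]] /=; rewrite ffunE eqxx; congr (_, _, (_, _, _)).
  by apply/ffunP => m; rewrite !ffunE; case: eqVneq => // ->.
have subi : injective sub.
  by apply: (can_inj (g := add)) => -[[i j] w]; rewrite /= subrK.
have addi : injective add.
  by apply: (can_inj (g := sub)) => -[[i j] w]; rewrite /= addrK.
have := realizesS (isometry_comp (isometry_perm R addi)
  (isometry_perm R (inv_inj swapK))) (realizes0 (isometry_perm R subi)).
congr (realizes _ _); apply/funext => phi; apply/funext => f.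
apply/funext => -[[i j] [[t e] c]] /=; rewrite query_op_subE /=.
by rewrite addrK.
Qed.

Fixpoint load_seq (ls : seq 'I_k) phi (f : B -> R) : B -> R :=
  if ls is l :: ls' then load_op l phi (load_seq ls' phi f) else f.

Lemma realizes_load_seq ls : realizes (size ls) (load_seq ls).
Proof.
elim: ls => [|l ls IH]; first exact: (realizes0 (@isometry_id _ _)).
exact: (realizes_comp IH (realizes_load l)).
Qed.

Definition start t : B := (0, 0, (t, false, ord0)).

(** A cell not yet loaded holds 0, so the swap returns the answer register to 0 for the next
    load. *)
Lemma load_seqE ls phi : uniq ls ->
  load_seq ls phi (ket R (start [ffun=> 0])) =
  ket R (start [ffun l => if l \in ls then phi (s l) else 0]).
Proof.
elim: ls => [_|l ls IH /= /andP[l_ls Uls]].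
  by congr (ket R (start _)); apply/ffunP => l; rewrite !ffunE.
rewrite IH // /load_op; apply: perm_ket (@load_basis_inj _ _) _.
rewrite /= ffunE mem_head add0r subrr; congr (_, _, (_, _, _)).
apply/ffunP => m; rewrite !ffunE inE.
by case: eqVneq => // ->; rewrite (negPf l_ls).
Qed.

Lemma load_enum phi :
  load_seq (enum 'I_k) phi (ket R (start [ffun=> 0])) = ket R (start (table phi)).
Proof.
rewrite load_seqE ?enum_uniq //; congr (ket R (start _)).
by apply/ffunP => l; rewrite !ffunE mem_enum.
Qed.

Let X : finType := ('I_n * bool)%type.
Let get (b : B) : X := let: (i, j, (t, e, c)) := b in (i, e).
Let put (x : X) (b : B) : B := let: (i, j, (t, e, c)) := b in (x.1, j, (t, x.2, c)).

Lemma isometry_on_search F : l2_isometry F ->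
  l2_isometry (lens_op (R := R) get put (fun=> F)).
Proof.
move=> Fi; apply: isometry_lens => //.
- by move=> [i e] [[i' j] [[t e'] c]].
- by move=> [[i' j] [[t e'] c]].
- by move=> [i e] [i2 e2] [[i' j] [[t e'] c]].
Qed.

Definition diffusion (f : B -> R) : B -> R :=
  lens_op get put (fun=> fun g x => 2 / #|X|%:R * (\sum_y g y) - g x) f.

Definition amp : R := Num.sqrt (#|X|%:R)^-1.

Definition prepare (f : B -> R) : B -> R :=
  lens_op get put (fun=> householder (ket R ((0, false) : X)) (fun=> amp)) f.

Definition oracle phi (f : B -> R) : B -> R := fun b =>
  let: (i, j, (t, e, c)) := b in
  (-1) ^+ (e && match_table t i (j + phi i)) * f b.

Definition check (l : nat) phi (f : B -> R) : B -> R := fun b =>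
  let: (i, j, (t, e, c)) := b in
  f (i, j, (t, e, if e && match_table t i (j + phi i)
                  then tperm ord0 (inord l) c else c)).

Lemma realizes_oracle : realizes 2 oracle.
Proof.
pose p (b : B) := let: (i, v, (t, e, c)) := b in e && match_table t i v.
have := realizes_conj (isometry_sign R p).
congr (realizes _ _); apply/funext => phi; apply/funext => f.
apply/funext => -[[i j] [[t e] c]]; rewrite /comp /unquery_op query_basisE /=.
by rewrite query_op_subE addrK.
Qed.

Lemma realizes_check l : realizes 2 (check l).
Proof.
pose p (b : B) : B := let: (i, v, (t, e, c)) := b in
  (i, v, (t, e, if e && match_table t i v then tperm ord0 (inord l) c else c)).
have pK : involutive p.
  move=> [[i v] [[t e] c]] /=.
  by case: (_ && _); rewrite ?tpermK.
have := realizes_conj (isometry_perm R (inv_inj pK)).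
congr (realizes _ _); apply/funext => phi; apply/funext => f.
apply/funext => -[[i j] [[t e] c]]; rewrite /comp /unquery_op query_basisE /=.
by rewrite query_op_subE addrK.
Qed.

Definition grover phi : (B -> R) -> B -> R := diffusion \o oracle phi.

Lemma realizes_grover : realizes 2 grover.
Proof.
exact: (realizes_comp realizes_oracle
  (realizes0 (isometry_on_search (isometry_mean_reflection R X)))).
Qed.

Fixpoint search (l : nat) (rs : seq nat) phi (f : B -> R) : B -> R :=
  if rs is r :: rs' then
    search l.+1 rs' phi (check l phi (iter r (grover phi) f))
  else f.

Lemma realizes_search l rs :
  realizes (\sum_(r <- rs) (r * 2 + 2))%N (search l rs).
Proof.
elim: rs l => [|r rs IH] l.
  by rewrite big_nil; exact: (realizes0 (@isometry_id _ _)).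
rewrite big_cons addnC [(r * 2 + 2)%N]addnC.
exact: (realizes_comp (realizes_comp (realizes_iter r realizes_grover)
  (realizes_check l)) (IH l.+1)).
Qed.

(* State before check [l]: [g] is the amplitude of the part not caught so far;
   indices [>= l] are still unused, so that swapping in index [l] removes the
   marked part from it. *)
Definition live (l : nat) phi (g : X -> R) (f : B -> R) : Prop :=
  (forall i j t e, f (i, j, (t, e, ord0)) =
     ((j == 0) && (t == table phi))%:R * g (i, e)) /\
  (forall i j t e (c : 'I_N.+1), (l <= c)%N -> (0 < c)%N ->
     f (i, j, (t, e, c)) = 0).

Lemma live_grover l phi g f : live l phi g f ->
  live l phi (fun x => 2 / #|X|%:R * (\sum_y (-1) ^+ marked phi y * g y)
                       - (-1) ^+ marked phi x * g x) (grover phi f).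
Proof.
move=> [f0 fl]; split=> [i j t e|i j t e c lc c0]; last first.
  rewrite /grover /diffusion /lens_op /= fl // mulr0 subr0 big1 ?mulr0// => y _.
  by rewrite fl // mulr0.
rewrite /grover /diffusion /lens_op /= f0.
under eq_bigr do rewrite f0.
have [/andP[/eqP -> /eqP ->]|_] := boolP ((j == 0) && (t == table phi)); last first.
  by rewrite !mul0r mulr0 subr0 big1 ?mulr0// => y _; rewrite mul0r mulr0.
rewrite !mul1r add0r; congr (_ * _ - _); apply: eq_bigr => -[y1 y2] _.
by rewrite !mul1r add0r.
Qed.

Lemma live_check l phi g f : (0 < l <= N)%N -> live l phi g f ->
  live l.+1 phi (fun x => if marked phi x then 0 else g x) (check l phi f).
Proof.
move=> /andP[l0 lN] [f0 fl]; split=> [i j t e|i j t e c lc c0] /=.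
  have [/andP[/eqP -> /eqP ->]|jt] := boolP ((j == 0) && (t == table phi)).
    rewrite add0r mul1r /marked /=; case: ifP => _; last first.
      by rewrite f0 !eqxx mul1r.
    by rewrite tpermL fl ?inordK.
  rewrite mul0r; case: ifP => _; last by rewrite f0 (negPf jt) mul0r.
  by rewrite tpermL fl ?inordK.
case: ifP => _; last by rewrite fl // ltnW.
rewrite tpermD ?fl //; first exact: ltnW.
  by rewrite -val_eqE /= eq_sym -lt0n.
by rewrite -val_eqE /= inordK // ltn_eqF.
Qed.

Section Amplitudes.
Variable phi : {ffun 'I_n -> 'I_n}.
Let M : nat := #|[set i | match_table (table phi) i (phi i)]|.
(** A fraction [M / (2 n) = sin^2 (t / 2)] of the states is marked, so this is [cos t] for the
    rotation angle [t] of one Grover iteration. *)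
Definition cos_angle : R := 1 - M%:R / n%:R.

Lemma sum_marked (a b : R) :
  \sum_(y : X) (if marked phi y then a else b) =
  n%:R * 2 * b + M%:R * (a - b).
Proof.
have -> : \sum_(y : X) (if marked phi y then a else b) =
    \sum_(y : X) b + \sum_(y : X) (if marked phi y then a - b else 0).
  by rewrite -big_split; apply: eq_bigr => y _ /=; case: ifP => _; ring.
rewrite sumr_const card_prod card_ord card_bool -[b *+ _]mulr_natl natrM.
congr (_ + _); rewrite -big_mkcond sumr_const -[LHS]mulr_natl; congr (_%:R * _).
rewrite /M -(card_imset _ (_ : injective (fun i : 'I_n => (i, true)))) => [|i j []//].
apply: eq_card => -[i e]; rewrite [LHS]/(marked phi (i, e)) /marked /=.
apply/idP/imsetP => [/andP[-> h]|[j]]; first by exists i => //; rewrite inE.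
by rewrite inE => h [-> ->].
Qed.

(** For [xu = (cos (r t), sin (r t) / sin t)] the marked amplitude is [a cot (t / 2) sin (r t)]; the
    factor [1 + cos_angle] avoids a division by zero when nothing is marked. *)
Definition two_level (a : R) (xu : R * R) (x : X) : R :=
  if marked phi x then a * ((1 + cos_angle) * xu.2) else a * xu.1.

Lemma live_iter l a f r : live l phi (two_level a (1, 0)) f ->
  live l phi (two_level a (cheb cos_angle r)) (iter r (grover phi) f).
Proof.
move=> f0; elim: r => // r /live_grover; rewrite -iterS chebS.
congr (live _ _ _ _); apply/funext => x; rewrite /two_level.
under eq_bigr => y _.
  rewrite (_ : _ * _ = if marked phi y then
    - (a * ((1 + cos_angle) * (cheb cos_angle r).2)) else
    a * (cheb cos_angle r).1); last by case: ifP => _; ring.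
over.
have n0 : n%:R != 0 :> R by rewrite pnatr_eq0.
rewrite sum_marked card_prod card_ord card_bool natrM /=.
case: (cheb _ r) => x0 u0 /=.
have -> : M%:R = (1 - cos_angle) * n%:R by rewrite /cos_angle; field.
by case: ifP => _; field.
Qed.

(** Each check removes the marked part, leaving the unmarked part scaled by [T_r], which is again a
    state of the initial form. The size bound provides a fresh index for every check. *)
Lemma live_search l a f rs : (0 < l)%N -> (l + size rs <= N.+1)%N ->
  live l phi (two_level a (1, 0)) f ->
  live (l + size rs) phi
    (two_level (a * \prod_(r <- rs) (cheb cos_angle r).1) (1, 0))
    (search l rs phi f).
Proof.
elim: rs l a f => [|r rs IH] l a f l0 lN f0; first by rewrite big_nil addn0 mulr1.
rewrite big_cons mulrA addnS -addSn /=; apply: IH => //; first by rewrite addSn -addnS.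
have lN' : (0 < l <= N)%N.
  by rewrite l0 -ltnS (leq_trans _ lN)//= addnS ltnS leq_addr.
have := live_check lN' (live_iter r f0); congr (live _ _ _ _).
by apply/funext => x; rewrite /two_level /=; case: (marked phi x); rewrite ?mulr0 ?mulr1.
Qed.

Lemma live_sum l a f : live l phi (two_level a (1, 0)) f ->
  \sum_(b : B | b.2.2 == ord0) f b ^+ 2 = a ^+ 2 * (2 * n - M)%:R.
Proof.
move=> [f0 _]; pose emb (x : X) : B := (x.1, 0, (table phi, x.2, ord0)).
rewrite (bigID (fun b => emb (get b) == b)) /= [X in _ + X]big1 ?addr0; last first.
  move=> [[i j] [[t e] c]] /andP[/= /eqP -> ne]; rewrite f0.
  have [/andP[/eqP jE /eqP tE]|_] := boolP ((j == 0) && (t == table phi)).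
    by move: ne; rewrite jE tE eqxx.
  by rewrite mul0r expr0n.
rewrite (reindex_onto emb get) => [|b /andP[_ /eqP]//] /=.
rewrite (eq_bigl predT) => [|[i e]]; last by rewrite /= !eqxx.
rewrite (eq_bigr (fun x => if marked phi x then 0 else a ^+ 2)); last first.
  move=> [i e] _; rewrite /emb f0 !eqxx mul1r /two_level /=.
  by case: ifP => _; rewrite ?mulr0 ?expr0n // mulr1.
have leM : (M <= 2 * n)%N.
  by rewrite (leq_trans (max_card _)) // card_ord leq_pmull.
by rewrite sum_marked natrB // natrM; ring.
Qed.

End Amplitudes.

Lemma amp_sqr : amp ^+ 2 = (2 * n)%:R^-1.
Proof. by rewrite sqr_sqrtr ?invr_ge0 // card_prod card_ord card_bool mulnC. Qed.

Lemma isometry_prepare : l2_isometry prepare.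
Proof. exact: (isometry_on_search (isometry_householder _ _)). Qed.

Lemma live_prepare phi :
  live 1 phi (fun=> amp) (prepare (ket R (start (table phi)))).
Proof.
have E i j t e (c : 'I_N.+1) :
    prepare (ket R (start (table phi))) (i, j, (t, e, c)) =
    [&& j == 0, t == table phi & c == ord0]%:R * amp.
  rewrite /prepare /lens_op [get _]/=.
  have -> : (fun x : X => ket R (start (table phi)) (put x (i, j, (t, e, c)))) =
      fun x => [&& j == 0, t == table phi & c == ord0]%:R * ket R (0, false) x.
    apply/funext => -[i' e']; rewrite /ket /= -natrM mulnb; congr (_%:R).
    rewrite !xpair_eqE eqbF_neg; congr nat_of_bool.
    by do !case: eqP => //=; rewrite ?andbF ?andbT.
  rewrite (isometryZ _ _ (isometry_householder _ _)) householderE ?sum_ket_sqr //.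
  rewrite sumr_const amp_sqr card_prod card_ord card_bool mulnC -[LHS]mulr_natl.
  by rewrite mulfV // pnatr_eq0.
split=> [i j t e|i j t e c c1 _]; rewrite E; first by rewrite andbT.
by rewrite -(val_eqE c) /= eqn0Ngt c1 !andbF mul0r.
Qed.

(** Check 1 clears the marked part of the uniform state, which gives the initial form
    [two_level phi amp (1, 0)]; hence the search starts at index 2. *)
Definition collision_search rs phi : (B -> R) -> B -> R :=
  search 2 rs phi \o (check 1 phi \o (prepare \o load_seq (enum 'I_k) phi)).

Lemma realizes_collision_search rs :
  realizes (\sum_(r <- rs) (r * 2 + 2) + (2 + (0 + k)))%N (collision_search rs).
Proof.
rewrite -{1}(size_enum_ord k).
exact: (realizes_comp (realizes_comp (realizes_comp (realizes_load_seq _)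
  (realizes0 isometry_prepare)) (realizes_check 1)) (realizes_search 2 rs)).
Qed.

Lemma collision_search_miss rs phi : (size rs < N)%N ->
  \sum_(b : B | b.2.2 == ord0)
    collision_search rs phi (ket R (start [ffun=> 0])) b ^+ 2 =
  (\prod_(r <- rs) (cheb (cos_angle phi) r).1) ^+ 2 *
  (1 - #|[set i | match_table (table phi) i (phi i)]|%:R / (2 * n)%:R).
Proof.
move=> rsN; rewrite /collision_search /= load_enum.
have l1 : (0 < 1 <= N)%N by rewrite (leq_ltn_trans _ rsN).
have := live_check l1 (live_prepare phi).
have -> : (fun x => if marked phi x then 0 else amp) = two_level phi amp (1, 0).
  by apply/funext => x; rewrite /two_level /=; case: ifP => _; ring.
move=> /(live_search (isT : (0 < 2)%N) (rs := rs)) live_end.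
rewrite (live_sum (live_end _)) ?addSn //.
rewrite exprMn amp_sqr mulrAC mulrC; congr (_ * _).
have leM : (#|[set i | match_table (table phi) i (phi i)]| <= 2 * n)%N.
  by rewrite (leq_trans (max_card _)) // card_ord leq_pmull.
have : (2 * n)%:R != 0 :> R by rewrite pnatr_eq0.
by rewrite natrB // => n0; field.
Qed.

End Search.

(** * Doubling sweeps, their cost and their miss probability *)

Lemma cheb_prod_le1 (R : realFieldType) (c : R) (rs : seq nat) :
  0 <= c <= 1 -> (\prod_(r <- rs) (cheb c r).1) ^+ 2 <= 1.
Proof.
move=> c01; elim: rs => [|r rs IH]; first by rewrite big_nil expr1n.
rewrite big_cons exprMn -[leRHS]mulr1 ler_pM ?sqr_ge0 //.
rewrite -(cheb_sqr c r) lerDl mulr_ge0 ?sqr_ge0 //; nra.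
Qed.

Definition sweeps (A p : nat) : seq nat :=
  flatten (nseq p [seq (2 ^ a)%N | a <- iota 0 A]).

Lemma prod_sweeps (R : realFieldType) (c : R) A p :
  \prod_(r <- sweeps A p) (cheb c r).1 = (\prod_(a < A) (cheb c (2 ^ a)).1) ^+ p.
Proof.
rewrite /sweeps; elim: p => [|p IH]; first by rewrite /= big_nil.
rewrite /= big_cat IH exprS big_map -(big_mkord xpredT (fun a => (cheb c (2 ^ a)).1)).
by rewrite /index_iota subn0.
Qed.

Lemma sweeps_cost A p : (\sum_(r <- sweeps A p) (r * 2 + 2) <= p * (4 * 2 ^ A))%N.
Proof.
have E a : (\sum_(r <- [seq (2 ^ i)%N | i <- iota 0 a]) (r * 2 + 2) + 2 <=
    4 * 2 ^ a)%N.
  elim: a => [|a IH]; first by rewrite big_nil.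
  have -> : iota 0 a.+1 = iota 0 a ++ [:: a] by rewrite -addn1 iotaD.
  rewrite map_cat big_cat /= big_seq1 expnS.
  have : (1 <= 2 ^ a)%N by rewrite expn_gt0.
  lia.
rewrite /sweeps; elim: p => [|p IH]; first by rewrite big_nil.
rewrite /= big_cat mulSn leq_add //.
by apply: leq_trans (E A); rewrite leq_addr.
Qed.

Section Algorithm.
Variables (R : realType) (n' k : nat).
Notation n := n'.+1.
Implicit Type phi : {ffun 'I_n -> 'I_n}.

Lemma match_table_partners phi (s : k.-tuple 'I_n) :
  [set i | match_table (tnth s) (table (tnth s) phi) i (phi i)] =
  partners phi (mem s).
Proof.
apply/setP => i; rewrite !inE; apply/existsP/existsP.
  by case=> l; rewrite ffunE => h; exists (tnth s l); rewrite inE mem_tnth.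
case=> j /and3P[/= js ji pji]; have [l jE] := tnthP _ _ js.
by exists l; rewrite ffunE -jE ji.
Qed.

(** If the sample has few colliding points the product is bounded by 1; otherwise at least [b]
    points are marked and each of the [p] sweeps contributes a factor at most [n / (4 ^ A b)]. *)
Lemma miss_bound phi (s : k.-tuple 'I_n) (b : R) A p :
  0 < b ->
  (\prod_(r <- sweeps A p) (cheb (cos_angle R (tnth s) phi) r).1) ^+ 2
    <= (#|colliding phi :&: [set x in s]|%:R < b)%R%:R
       + (n%:R / (4 ^+ A * b)) ^+ p.
Proof.
move=> b0; rewrite /cos_angle match_table_partners.
set M := #|_|; set c := 1 - _.
have n0 : 0 < n%:R :> R by rewrite ltr0n.
have Mn : M%:R <= n%:R :> R.
  by rewrite ler_nat (leq_trans (max_card _)) ?card_ord.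
have c01 : 0 <= c <= 1.
  by rewrite subr_ge0 gerBl divr_ge0 ?ler0n // ler_pdivrMr // mul1r Mn.
have e_ge0 : 0 <= n%:R / (4 ^+ A * b) :> R.
  by rewrite divr_ge0 ?mulr_ge0 ?exprn_ge0 ?ler0n // ltW.
case: ltP => [_|hits].
  by rewrite (le_trans (cheb_prod_le1 _ c01)) // lerDl exprn_ge0.
rewrite add0r prod_sweeps -exprM mulnC exprM; apply: lerXn2r; rewrite ?nnegrE ?sqr_ge0 //.
have bM : b <= M%:R.
  by rewrite (le_trans hits) // ler_nat; exact: leq_card_partners.
have := cheb_prod_bound c A; set P := (\prod_(_ < _) _) ^+ 2 => PA.
have P0 : 0 <= P by exact: sqr_ge0.
rewrite ler_pdivlMr ?mulr_gt0 ?exprn_gt0 //.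
(* [1 - c] is [M / n], and [c ^+ 2 <= c] because [0 <= c <= 1]. *)
have c1 : b / n%:R <= 1 - c ^+ 2.
  have : b / n%:R <= 1 - c by rewrite opprB addrC subrK ler_pM2r ?invr_gt0.
  move=> /le_trans; apply; rewrite lerD2l lerN2 expr2.
  by case/andP: c01 => c0 c1; rewrite ler_piMl.
have : P * (4 ^+ A * (b / n%:R)) <= 1.
  apply: le_trans PA; rewrite mulrC ler_wpM2r // ler_wpM2l // exprn_ge0 //.
by rewrite !mulrA ler_pdivrMr // mul1r.
Qed.

End Algorithm.

(** Acceptance means that the counter is still 0. Permutations are always accepted; the two error
    terms are a poor sample and a missed search. *)
Lemma permutation_tester (R : realType) (n k : nat) (alpha b : R) A p :
  (0 < n)%N -> 0 < alpha < 1 -> 0 < b -> b <= (1 - alpha) / 2 * n%:R ->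
  exists Q : query_algorithm R n,
    (qcost Q <= p * (4 * 2 ^ A) + 2 + k)%N /\
    computes_with_error Q (ptp_dom alpha) (@ptp n)
      (expR (b - k%:R * ((1 - alpha) / 4)) + (n%:R / (4 ^+ A * b)) ^+ p).
Proof.
case: n => // n' _ alpha01 b0 bn; set eps := _ + _.
set rs := sweeps A p; pose N := (size rs).+1.
have n0 : 0 < n'.+1%:R :> R by rewrite ltr0n.
have eps0 : 0 <= eps.
  by rewrite addr_ge0 ?expR_ge0 ?exprn_ge0 ?divr_ge0 ?mulr_ge0 ?exprn_ge0 ?ler0n // ltW.
have [Q [QT QP]] := mixture (start N [ffun=> 0]) [tuple of nseq k (ord0 : 'I_n'.+1)]
  (fun b => b.2.2 == ord0)
  (fun s : k.-tuple 'I_n'.+1 => realizes_collision_search R N (tnth s) rs).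
have trueE phi : prob_output Q phi true = (n'.+1%:R ^+ k)^-1 *
    \sum_(s : k.-tuple 'I_n'.+1) (\prod_(r <- rs) (cheb (cos_angle R (tnth s) phi) r).1) ^+ 2 *
       (1 - #|partners phi (mem s)|%:R / (2 * n'.+1)%:R).
  rewrite QP card_tuple card_ord natrX; congr (_ * _); apply: eq_bigr => s _.
  rewrite (eq_bigl (fun b => b.2.2 == ord0)) => [|c]; last exact: eqb_id.
  by rewrite collision_search_miss // match_table_partners.
have nk0 : 0 < n'.+1%:R ^+ k :> R by rewrite exprn_gt0.
exists Q; split.
  by rewrite QT add0n -addnA leq_add2r sweeps_cost.
move=> phi phiD.
have [phi_perm|phi_far] := boolP (ptp phi).
  have phi_inj : injective phi.
    apply/injectiveP/card_uniqP; rewrite -codomE; move/eqP: phi_perm => ->.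
    by rewrite size_codom card_ord.
  rewrite trueE (eq_bigr (fun=> 1)) => [|s _]; last first.
    rewrite /cos_angle match_table_partners partners_inj // cards0 !mul0r !subr0 mulr1.
    by rewrite big1 ?expr1n // => r _; exact: cheb_one.
  by rewrite sumr_const card_tuple card_ord natrX mulVf ?gt_eqF // gerBl.
have far : #|codom phi|%:R <= alpha * n'.+1%:R.
  by case: phiD => // h; move: phi_far; rewrite /ptp h eqxx.
rewrite lerBlDr -(prob_output_sum Q phi) addrC lerD2l trueE ler_pdivrMl //.
(* At least [(1 - alpha) n] points collide: one half covers [b], the other gives the fresh-draw rate
   [q = (1 - alpha) / 2]. *)
have Dq : (1 - alpha) / 2 * n'.+1%:R + b <= #|colliding phi|%:R.
  have : n'.+1%:R <= #|colliding phi|%:R + #|codom phi|%:R :> R.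
    by rewrite -natrD ler_nat; have := card_colliding phi; rewrite card_ord.
  lra.
have few := card_few_hits k (ltW b0) Dq.
apply: (@le_trans _ _ (\sum_(s : k.-tuple 'I_n'.+1)
   ((#|colliding phi :&: [set x in s]|%:R < b)%R%:R
       + (n'.+1%:R / (4 ^+ A * b)) ^+ p))).
  apply: ler_sum => s _; apply: le_trans (miss_bound phi s A p b0).
  by rewrite ler_piMr ?sqr_ge0 // gerBl divr_ge0.
rewrite big_split /= sumr_const card_tuple card_ord -[X in _ + X]mulr_natl natrX.
rewrite /eps mulrDr lerD2r.
have -> : (1 - alpha) / 4 = (1 - alpha) / 2 / 2 by field.
by apply: few; lra.
Qed.

(** * Choice of the parameters and the resulting rate *)

Lemma pow2_near (R : realType) (y : R) : 1 <= y ->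
  exists A : nat, y <= 2 ^+ A <= 2 * y.
Proof.
move=> y1.
have exA : exists A : nat, y <= 2 ^+ A.
  exists (Num.truncn y).+1; apply: (@le_trans _ _ (Num.truncn y).+1%:R).
    by rewrite ltW // truncnS_gt.
  by rewrite -natrX ler_nat ltnW // ltn_expl.
case: (ex_minnP exA) => A yA Amin; exists A; rewrite yA /=.
case: A yA Amin => [|A] yA Amin; first by rewrite expr0; lra.
rewrite exprS ler_pM2l //; case: (leP (2 ^+ A) y) => // /ltW /Amin.
by rewrite ltnn.
Qed.

Lemma ln3_bounds (R : realType) : 2 / 3 <= ln (3 : R) <= 2.
Proof.
apply/andP; split.
  rewrite -ler_expR lnK ?posrE // -[X in X <= _]invrK -expRN.
  have := expR_ge1Dx (- (2 / 3) : R) => h.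
  rewrite -[leRHS]invrK lef_pV2 ?posrE ?expR_gt0 ?invr_gt0 //; lra.
rewrite -ler_expR lnK ?posrE //; have := expR_ge1Dx (2 : R); lra.
Qed.

Lemma expRN1_bounds (R : realType) : 4^-1 <= expR (-1 : R) <= 2^-1.
Proof.
apply/andP; split; last first.
  by rewrite expRN lef_pV2 ?posrE ?expR_gt0 //; have := expR_ge1Dx (1 : R); lra.
have -> : -1 = - 2^-1 + - 2^-1 :> R by field.
rewrite expRD; have := expR_ge1Dx (- 2^-1 : R); nra.
Qed.

Section Rate.
Variables (R : realType) (n : nat) (eps : R).
Hypotheses (n_gt0 : (1 <= n)%N) (epsP : 3%:R ^- n <= eps <= 3%:R^-1).
Let L : R := ln eps^-1.

Definition rate : R := n%:R `^ (1 / 3%:R) * L `^ (2%:R / 3%:R).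

Lemma eps_gt0 : 0 < eps.
Proof. by case/andP: epsP => + _; apply: lt_le_trans; rewrite invr_gt0 exprn_gt0. Qed.

Lemma ln_eps_bounds : 2 / 3 <= L <= 2 * n%:R.
Proof.
have /andP[l3 u3] := ln3_bounds R; have e0 := eps_gt0.
have ie0 : 0 < eps^-1 by rewrite invr_gt0.
case/andP: epsP => lo hi; apply/andP; split.
  apply: le_trans l3 _; rewrite ler_ln ?posrE //.
  by rewrite -[leLHS]invrK lef_pV2 ?posrE ?invr_gt0.
apply: (@le_trans _ _ (n%:R * ln 3)); last by rewrite mulrC ler_pM2r ?ltr0n.
rewrite mulr_natl -lnXn // ler_ln ?posrE ?exprn_gt0 //.
by rewrite -[leRHS]invrK lef_pV2 ?posrE ?invr_gt0 ?exprn_gt0.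
Qed.

(** This polynomial identity replaces the fractional powers in the later estimates. *)
Lemma rate_cube : rate ^+ 3 = n%:R * L ^+ 2.
Proof.
have /andP[L0 _] := ln_eps_bounds; have L0' : 0 <= L by lra.
rewrite exprMn -!powR_mulrn ?powR_ge0 // -!powRrM.
by rewrite !mulfVK ?pnatr_eq0 // powRr1 // powR_mulrn.
Qed.

(** Compare cubes: by [L <= 2 n], the cube [n L^2] lies between [L^3 / 2] and [4 n^3]. *)
Lemma rate_bounds : L / 2 <= rate <= 2 * n%:R.
Proof.
have /andP[L0 Ln] := ln_eps_bounds; have := rate_cube.
have m0 : 0 <= rate by rewrite mulr_ge0 ?powR_ge0.
have n0 : 1 <= n%:R :> R by rewrite ler1n.
move: rate m0 => m m0 m3.
have h1 : L ^+ 3 <= 2 * n%:R * L ^+ 2 by rewrite exprS ler_wpM2r ?sqr_ge0.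
have h2 : L ^+ 2 <= (2 * n%:R) ^+ 2 by rewrite ler_sqr ?nnegrE; lra.
apply/andP; split.
  rewrite -(@ler_pXn2r _ 3) ?nnegrE //; last by lra.
  rewrite m3 exprMn; have : 0 <= L ^+ 3 by rewrite exprn_ge0; lra.
  have -> : 2^-1 ^+ 3 = 8^-1 :> R by field.
  lra.
rewrite -(@ler_pXn2r _ 3) ?nnegrE ?mulr_ge0 ?ler0n //.
have h3 : n%:R * L ^+ 2 <= n%:R * (2 * n%:R) ^+ 2 by rewrite ler_wpM2l //; lra.
rewrite m3 (le_trans h3) // !exprMn.
have -> : n%:R * (2 ^+ 2 * n%:R ^+ 2) = 4 * n%:R ^+ 3 :> R by ring.
have -> : 2 ^+ 3 = 8 :> R by ring.
by rewrite ler_pM2r ?exprn_gt0 ?ltr0n // ler_nat.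
Qed.

Lemma ptp_algorithm (alpha : R) : 0 < alpha < 1 ->
  exists A : query_algorithm R n,
    computes_with_error A (ptp_dom alpha) (@ptp n) eps /\
    (qcost A)%:R <= 158 / (1 - alpha) * rate.
Proof.
move=> alpha01; have /andP[L0 Ln] := ln_eps_bounds.
move: rate rate_bounds rate_cube => m /andP[mL mn] m3.
have [g0 g1] : 0 < 1 - alpha /\ 1 - alpha < 1 by lra.
have [g gE] : exists g, 1 - alpha = g by exists (1 - alpha).
rewrite gE in g0 g1 *.
have m0 : 0 < m by lra.
have n0 : 0 < n%:R :> R by rewrite ltr0n.
(* The factor 1/4 gives [b <= g n / 2] through [m <= 2 n]. *)
have [b bE] : exists b, g * m / 4 = b by exists (g * m / 4).
have b0 : 0 < b by rewrite -bE divr_gt0 ?mulr_gt0.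
have bn : b <= g / 2 * n%:R.
  have : g * m <= g * (2 * n%:R) by rewrite ler_pM2l.
  by rewrite -bE; lra.
have nb0 : 0 <= n%:R / b by rewrite divr_ge0 ?ltW.
(* With [2 ^ A >= y], the miss factor [n / (4 ^ A b)] is at most [1 / 4], hence at most
   [exp (-1)]. *)
pose y := 2 * Num.sqrt (n%:R / b).
have y2 : y ^+ 2 = 4 * (n%:R / b) by rewrite exprMn sqr_sqrtr //; ring.
have y0 : 0 <= y by rewrite mulr_ge0 ?sqrtr_ge0.
have y1 : 1 <= y.
  rewrite -ler_sqr ?nnegrE // expr1n y2.
  have : 1 <= n%:R / b by rewrite ler_pdivlMr // mul1r; nra.
  lra.
have [A /andP[Ay yA]] := pow2_near y1.
(* [k g / 4 - b >= 21 m / 4 - m / 4 = 5 m >= L + 1], by [m >= L / 2] and [L >= 2 / 3]. *)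
have [k k_lo k_hi] : exists2 k : nat, 21 / g * m <= k%:R & k%:R <= 21 / g * m + 1.
  exists (Num.truncn (21 / g * m)).+1; first by rewrite ltW // truncnS_gt.
  by rewrite -natr1 lerD2r truncn_le // mulr_ge0 ?divr_ge0 ?ltW.
(* [p >= L + 1] bounds the search error by [exp (- L - 1) <= eps / 2]. *)
have [p p_lo p_hi] : exists2 p : nat, L + 1 <= p%:R & p%:R <= L + 2.
  exists (Num.truncn (L + 1)).+1; first by rewrite ltW // truncnS_gt.
  have : (Num.truncn (L + 1))%:R <= L + 1 by rewrite truncn_le //; lra.
  by rewrite -natr1; lra.
have bn' : b <= (1 - alpha) / 2 * n%:R by rewrite gE.
have [Q [Qc Qe]] := permutation_tester k A p n_gt0 alpha01 b0 bn'.
have /andP[e4 e2] := expRN1_bounds R.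
have eps_half : expR (- (L + 1)) <= eps / 2.
  rewrite opprD expRD expRN /L lnK ?posrE ?invr_gt0 ?eps_gt0 // invrK.
  by rewrite ler_pM2l ?eps_gt0.
exists Q; split.
  move=> phi /Qe; apply: le_trans; rewrite lerD2l lerN2.
  have -> : eps = eps / 2 + eps / 2 by field.
  apply: lerD; apply: le_trans eps_half.
    rewrite ler_expR gE.
    have : 21 * m <= k%:R * g by rewrite -ler_pdivrMr // mulrAC.
    have : b <= m / 4.
      rewrite -bE ler_pM2r // ler_piMl //; exact: ltW.
    lra.
  apply: (@le_trans _ _ (expR (-1 : R) ^+ p)); last first.
    by rewrite -expRM_natl ler_expR; lra.
  apply: lerXn2r; rewrite ?nnegrE ?expR_ge0 //.
    by rewrite divr_ge0 ?mulr_ge0 ?exprn_ge0 ?ltW.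
  apply: le_trans e4; rewrite ler_pdivrMr ?mulr_gt0 ?exprn_gt0 //.
  have : y ^+ 2 <= 4 ^+ A.
    have -> : 4 ^+ A = (2 ^+ A) ^+ 2 :> R.
      by rewrite -exprM mulnC exprM; congr (_ ^+ _); ring.
    by rewrite ler_sqr ?nnegrE // exprn_ge0.
  rewrite y2 mulrA ler_pdivrMr //; lra.
(* By [b = g m / 4] and [m^3 = n L^2], the square of [L y] is [16 m^2 / g], and [g < 1]. *)
have Ly : L * y <= 4 * (m / g).
  have mg0 : 0 <= 4 * (m / g) by rewrite mulr_ge0 // ltW // divr_gt0.
  have L0' : 0 <= L by lra.
  rewrite -ler_sqr ?nnegrE // ?mulr_ge0 //.
  rewrite exprMn y2.
  have -> : L ^+ 2 * (4 * (n%:R / b)) = 16 * (n%:R * L ^+ 2) / (g * m).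
    by rewrite -bE; field; rewrite !gt_eqF.
  rewrite -m3 exprMn expr_div_n.
  have -> : 16 * m ^+ 3 / (g * m) = 16 * m ^+ 2 / g by field; rewrite !gt_eqF.
  have -> : 4 ^+ 2 * (m ^+ 2 / g ^+ 2) = 16 * m ^+ 2 / g * g^-1.
    by field; rewrite gt_eqF.
  by rewrite ler_peMr ?divr_ge0 ?mulr_ge0 ?sqr_ge0 // ?invf_ge1 // ltW.
have mg : m <= m / g by rewrite ler_pdivlMr // ler_piMr // ltW.
apply: (@le_trans _ _ (p * (4 * 2 ^ A) + 2 + k)%N%:R); first by rewrite ler_nat.
rewrite !natrD !natrM natrX.
(* [p <= L + 2 <= 4 L] by [L >= 2 / 3], and [2 ^ A <= 2 y]. *)
have pA : p%:R * (4 * 2 ^+ A) <= 32 * (L * y).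
  have -> : 32 * (L * y) = 4 * L * (4 * (2 * y)) by ring.
  by apply: ler_pM; rewrite ?ler0n ?mulr_ge0 ?exprn_ge0 //; lra.
(* 158 = 128 + 21 + 9: in units of [m / g] the sweeps cost at most [32 * 4] and the sample 21, up to
   an additive 3, which is at most [9 m] because [m >= 1 / 3]. *)
have -> : 158 / g * m = 158 * (m / g) by rewrite mulrAC mulrA.
have : 21 / g * m = 21 * (m / g) by rewrite mulrAC mulrA.
lra.
Qed.
End Rate.

Unset Implicit Arguments.

Theorem theorem3p8 (R : realType) (alpha : R)
    (alpha_gt0 : 0 < alpha) (alpha_lt1 : alpha < 1) :
  (exists C : R, 0 < C /\
     forall (n : nat) (eps : R), (1 <= n)%N -> 3%:R ^- n <= eps <= 3%:R^-1 ->
       exists A : query_algorithm R n,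
         computes_with_error A (ptp_dom alpha) (@ptp n) eps /\
         (qcost A)%:R
           <= C * (n%:R `^ (1 / 3%:R) * (ln (eps^-1)) `^ (2%:R / 3%:R))) /\
  (exists C : R, 0 < C /\
     forall (n : nat) (eps : R), (1 <= n)%N -> 3%:R ^- n <= eps <= 3%:R^-1 ->
       (approx_deg (@ptp_points R n alpha) (@ptp_fun R n) eps
          <= (C * (n%:R `^ (1 / 3%:R) * (ln (eps^-1)) `^ (2%:R / 3%:R)))%:E)%E).
Proof.
have alpha01 : 0 < alpha < 1 by rewrite alpha_gt0.
have C0 : 0 < 158 / (1 - alpha) by rewrite divr_gt0 // subr_gt0.
(* The acceptance polynomial has degree at most twice the query count, hence the factor 2. *)
split; [exists (158 / (1 - alpha)) | exists (2 * (158 / (1 - alpha)))].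
  by split=> // n eps n_gt0 epsP; exact: ptp_algorithm.
split=> [|n eps n_gt0 epsP]; first by rewrite mulr_gt0.
have [A [Aerr Acost]] := ptp_algorithm n_gt0 epsP alpha01.
have [p [pdeg pE]] := prob_output_poly A true.
apply: (@le_trans _ _ ((msize p).-1%:R)%:E); last first.
  rewrite lee_fin -mulrA (le_trans _ (ler_wpM2l _ Acost)) //.
  by rewrite -natrM ler_nat; case: (msize p) pdeg.
apply: ereal_inf_lbound; exists p => // _ [phi phiD <-].
rewrite pE ptp_funE ler_distl; move: (Aerr _ phiD) (prob_output_sum A phi).
have := prob_output_ge0 A phi true; have := prob_output_ge0 A phi false.
(* When [ptp phi] is false, acceptance has the complement of a probability at least [1 - eps]. *)
by case: (ptp phi) => /= ? ? ? ?; lra.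
Qed.
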